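(* Let $(\mathcal{C},\otimes,1)$ be a monoidal category, let $B$ be a bimonad on $\mathcal{C}$, and let $K$ be a monad on a right $\mathcal{C}$-module category $(\mathcal{M},\lhd)$. Then coactions of $B$ on $K$ are in bijection with right actions of the monoidal category $\mathcal{C}^B$ on the category $\mathcal{M}^K$ such that the forgetful functor $U^K\colon \mathcal{M}^K\to\mathcal{M}$ is a strict comodule functor over the forgetful functor $U^B\colon \mathcal{C}^B\to\mathcal{C}$.
   Context: Associativity and unit constraints of monoidal and module categories are suppressed and are to be inserted where needed. Right module category: a right $\mathcal{C}$-module category is a category $\mathcal{M}$ with an action functor $\lhd\colon\mathcal{M}\times\mathcal{C}\to\mathcal{M}$ and natural associativity and unit isomorphisms $m\lhd(x\otimes y)\cong(m\lhd x)\lhd y$, $m\lhd 1\cong m$ satisfying the usual pentagon and triangle axioms. A right action of a monoidal category on a category is such a structure. Opmonoidal functor: a functor $F\colon\mathcal{C}\to\mathcal{D}$ between monoidal categories with a natural transformation $F_{2;x,y}\colon F(x\otimes y)\to Fx\otimes Fy$ and a morphism $F_0\colon F1\to 1$ that are coassociative, $(Fx\otimes F_{2;y,z})\circ F_{2;x,y\otimes z}=(F_{2;x,y}\otimes Fz)\circ F_{2;x\otimes y,z}$, and counital, $(F_0\otimes Fx)\circ F_{2;1,x}=\mathrm{id}_{Fx}=(Fx\otimes F_0)\circ F_{2;x,1}$. It is strict monoidal if $F_2$ and $F_0$ are identities. A natural transformation $\rho\colon F\Rightarrow G$ of opmonoidal functors is opmonoidal if $G_{2;x,y}\circ\rho_{x\otimes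 y}=(\rho_x\otimes\rho_y)\circ F_{2;x,y}$ and $G_0\circ\rho_1=F_0$. Bimonad: a bimonad on $\mathcal{C}$ is a monad $(B,\mu,\eta)$ on $\mathcal{C}$ whose underlying endofunctor is opmonoidal, $(B,B_2,B_0)$, and such that $\mu\colon B^2\Rightarrow B$ and $\eta\colon\mathrm{Id}_{\mathcal{C}}\Rightarrow B$ are opmonoidal natural transformations (here $B^2$ has comultiplication $B_{2;Bx,By}\circ B(B_{2;x,y})$ and counit $B_0\circ B(B_0)$). Eilenberg–Moore categories: $\mathcal{C}^B$ and $\mathcal{M}^K$ are the categories of algebras $(x,\vartheta_x)$ of $B$ and $(m,\vartheta_m)$ of $K$, with forgetful functors $U^B$, $U^K$. The category $\mathcal{C}^B$ is monoidal with $(x,\vartheta_x)\otimes(y,\vartheta_y)=(x\otimes y,(\vartheta_x\otimes\vartheta_y)\circ B_{2;x,y})$ and unit $(1,B_0)$, so that $U^B$ is strict monoidal. Comodule functor: let $(\mathcal{M},\lhd)$ be a right $\mathcal{C}$-module category, $(\mathcal{N},\blacktriangleleft)$ a right $\mathcal{D}$-module category, and $F\colon\mathcal{C}\to\mathcal{D}$ an opmonoidal functor. A comodule functor over $F$ is a functor $G\colon\mathcal{M}\to\mathcal{N}$ with a natural transformation (its coaction) $\delta_{m,x}\colon G(m\lhd x)\to Gm\blacktriangleleft Fx$ that is coassociative, $(Gm\blacktriangleleft F_{2;x,y})\circ\delta_{m,x\otimes y}=(\delta_{m,x}\blacktriangleleft Fy)\circ\delta_{m\lhd x,y}$, and counital,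 $(Gm\blacktriangleleft F_0)\circ\delta_{m,1}=\mathrm{id}_{Gm}$. It is strict if its coaction is the identity (in particular $G(m\lhd x)=Gm\blacktriangleleft Fx$). Coaction of $B$ on $K$: for a monad $(K,\mu,\eta)$ on $\mathcal{M}$, a coaction of $B$ on $K$ is a natural transformation $\delta_{m,x}\colon K(m\lhd x)\to Km\lhd Bx$ making $K$ a comodule functor over $B$ and such that $(K,\delta)$ is a comodule monad over $B$, i.e. for all $m\in\mathcal{M}$, $x\in\mathcal{C}$, $$\delta_{m,x}\circ\mu^{K}_{m\lhd x}=(\mu^{K}_m\lhd\mu^{B}_x)\circ\delta_{Km,Bx}\circ K(\delta_{m,x}),\qquad \delta_{m,x}\circ\eta^{K}_{m\lhd x}=\eta^{K}_m\lhd\eta^{B}_x .$$ *)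

(* Defs.v *)
From mathcomp Require Import ssreflect ssrfun.
From Stdlib Require Import ProofIrrelevance.

Set Implicit Arguments.
Unset Strict Implicit.
Unset Printing Implicit Defensive.

Declare Scope cat_scope.
Local Open Scope cat_scope.

(* Objects and morphisms are compared with Leibniz equality, so coactions and
   actions form plain types, between which a bijection makes sense. *)
Record category := Category {
  obj :> Type;
  hom : obj -> obj -> Type;
  idm : forall x, hom x x;
  cmp : forall x y z, hom y z -> hom x y -> hom x z;
  cmpA : forall x y z w (h : hom z w) (g : hom y z) (f : hom x y),
    cmp h (cmp g f) = cmp (cmp h g) f;
  cmp1m : forall x y (f : hom x y), cmp (idm y) f = f;
  cmpm1 : forall x y (f : hom x y), cmp f (idm x) = f
}.
Arguments hom {c} x y.
Arguments idm {c} x.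
Arguments cmp {c x y z} g f.

Notation "g ∘ f" := (cmp g f) (at level 40, left associativity) : cat_scope.

Definition is_iso (C : category) (x y : C) (f : hom x y) : Prop :=
  exists g : hom y x, g ∘ f = idm x /\ f ∘ g = idm y.

(* An equality of objects, seen as the identity morphism between them. *)
Definition eq_mor (C : category) (x y : C) (e : x = y) : hom x y :=
  match e in _ = z return hom x z with erefl => idm x end.

Record functor (C D : category) := Functor {
  fob :> C -> D;
  fmap : forall x y : C, hom x y -> hom (fob x) (fob y);
  fmap1 : forall x : C, fmap (idm x) = idm (fob x);
  fmapM : forall (x y z : C) (g : hom y z) (f : hom x y),
    fmap (g ∘ f) = fmap g ∘ fmap f
}.
Arguments fmap {C D} _ {x y} _.

Definition functor_id (C : category) : functor C C :=
  @Functor C C (fun x => x) (fun x y f => f)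
    (fun x => erefl) (fun x y z g f => erefl).

Section FunctorComp.
Context (C D E : category) (G : functor D E) (F : functor C D).

Lemma functor_comp1 (x : C) : fmap G (fmap F (idm x)) = idm (G (F x)).
Proof. by rewrite !fmap1. Qed.

Lemma functor_compM (x y z : C) (g : hom y z) (f : hom x y) :
  fmap G (fmap F (g ∘ f)) = fmap G (fmap F g) ∘ fmap G (fmap F f).
Proof. by rewrite !fmapM. Qed.

Definition functor_comp : functor C E :=
  @Functor C E (fun x => G (F x)) (fun x y f => fmap G (fmap F f))
    functor_comp1 functor_compM.
End FunctorComp.

Record nattrans (C D : category) (F G : functor C D) := NatTrans {
  ncomp :> forall x : C, hom (F x) (G x);
  nat_sq : forall (x y : C) (f : hom x y),
    fmap G f ∘ ncomp x = ncomp y ∘ fmap F f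
}.

Section ProdCat.
Context (C D : category).

Definition prod_hom (p q : C * D) : Type := (hom p.1 q.1 * hom p.2 q.2)%type.

Lemma prod_cmp1m (p q : C * D) (f : prod_hom p q) :
  (idm q.1 ∘ f.1, idm q.2 ∘ f.2) = f.
Proof. by rewrite !cmp1m; case: f. Qed.

Lemma prod_cmpm1 (p q : C * D) (f : prod_hom p q) :
  (f.1 ∘ idm p.1, f.2 ∘ idm p.2) = f.
Proof. by rewrite !cmpm1; case: f. Qed.

Lemma prod_cmpA (p q r s : C * D)
    (h : prod_hom r s) (g : prod_hom q r) (f : prod_hom p q) :
  (h.1 ∘ (g.1 ∘ f.1), h.2 ∘ (g.2 ∘ f.2))
    = ((h.1 ∘ g.1) ∘ f.1, (h.2 ∘ g.2) ∘ f.2).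
Proof. by rewrite !cmpA. Qed.

Definition prodcat : category :=
  @Category (C * D)%type prod_hom
    (fun p => (idm p.1, idm p.2))
    (fun p q r g f => (g.1 ∘ f.1, g.2 ∘ f.2))
    prod_cmpA prod_cmp1m prod_cmpm1.
End ProdCat.

Definition bmap (C D E : category) (F : functor (prodcat C D) E)
    (x x' : C) (y y' : D) (f : hom x x') (g : hom y y') :
    hom (F (x, y)) (F (x', y')) :=
  @fmap _ _ F (x, y) (x', y') (f, g).

Lemma bmap1 (C D E : category) (F : functor (prodcat C D) E) (x : C) (y : D) :
  bmap F (idm x) (idm y) = idm (F (x, y)).
Proof. exact: (@fmap1 _ _ F (x, y)). Qed.

Lemma bmapM (C D E : category) (F : functor (prodcat C D) E)
    (x x' x'' : C) (y y' y'' : D) (f' : hom x' x'') (f : hom x x')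
    (g' : hom y' y'') (g : hom y y') :
  bmap F (f' ∘ f) (g' ∘ g) = bmap F f' g' ∘ bmap F f g.
Proof. exact: (@fmapM _ _ F (x, y) (x', y') (x'', y'') (f', g') (f, g)). Qed.

Record monoidal := Monoidal {
  mcat :> category;
  tensor : functor (prodcat mcat mcat) mcat;
  tunit : mcat;
  tassoc : forall x y z : mcat,
    hom (tensor (tensor (x, y), z)) (tensor (x, tensor (y, z)));
  tunitl : forall x : mcat, hom (tensor (tunit, x)) x;
  tunitr : forall x : mcat, hom (tensor (x, tunit)) x;
  tassoc_iso : forall x y z, is_iso (tassoc x y z);
  tunitl_iso : forall x, is_iso (tunitl x);
  tunitr_iso : forall x, is_iso (tunitr x);
  tassoc_nat : forall (x x' y y' z z' : mcat)
      (f : hom x x') (g : hom y y') (h : hom z z'),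
    bmap tensor f (bmap tensor g h) ∘ tassoc x y z
      = tassoc x' y' z' ∘ bmap tensor (bmap tensor f g) h;
  tunitl_nat : forall (x x' : mcat) (f : hom x x'),
    f ∘ tunitl x = tunitl x' ∘ bmap tensor (idm tunit) f;
  tunitr_nat : forall (x x' : mcat) (f : hom x x'),
    f ∘ tunitr x = tunitr x' ∘ bmap tensor f (idm tunit);
  tpentagon : forall w x y z : mcat,
    bmap tensor (idm w) (tassoc x y z)
      ∘ tassoc w (tensor (x, y)) z
      ∘ bmap tensor (tassoc w x y) (idm z)
    = tassoc w x (tensor (y, z)) ∘ tassoc (tensor (w, x)) y z;
  ttriangle : forall x y : mcat,
    bmap tensor (idm x) (tunitl y) ∘ tassoc x tunit y
      = bmap tensor (tunitr x) (idm y)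
}.
Arguments tensor {m}.
Arguments tunit {m}.
Arguments tassoc {m} x y z.
Arguments tunitl {m} x.
Arguments tunitr {m} x.

Notation "x ⊗ y" := (fob tensor (x, y))
  (at level 38, left associativity) : cat_scope.
Notation "f ⊠ g" := (bmap tensor f g)
  (at level 38, left associativity) : cat_scope.

(* Given A : right_action C M, the object m ◁ x is A (m, x) and the morphism
   f ◁ g is bmap A f g. *)
Record right_action (C : monoidal) (M : category) := RightAction {
  act :> functor (prodcat M C) M;
  aassoc : forall (m : M) (x y : C), hom (act (m, x ⊗ y)) (act (act (m, x), y));
  aunit : forall m : M, hom (act (m, tunit)) m;
  aassoc_iso : forall m x y, is_iso (aassoc m x y);
  aunit_iso : forall m, is_iso (aunit m);
  aassoc_nat : forall (m m' : M) (x x' y y' : C)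
      (f : hom m m') (g : hom x x') (h : hom y y'),
    bmap act (bmap act f g) h ∘ aassoc m x y
      = aassoc m' x' y' ∘ bmap act f (g ⊠ h);
  aunit_nat : forall (m m' : M) (f : hom m m'),
    f ∘ aunit m = aunit m' ∘ bmap act f (idm tunit);
  apentagon : forall (m : M) (x y z : C),
    bmap act (aassoc m x y) (idm z) ∘ aassoc m (x ⊗ y) z
      = aassoc (act (m, x)) y z ∘ aassoc m x (y ⊗ z)
          ∘ bmap act (idm m) (tassoc x y z);
  atriangle : forall (m : M) (x : C),
    bmap act (aunit m) (idm x) ∘ aassoc m tunit x
      = bmap act (idm m) (tunitl x)
}.
Arguments aassoc {C M} r m x y.
Arguments aunit {C M} r m.

(* The coherence constraints, suppressed in the usual formulation of these
   axioms, are inserted so that no inverse constraint is needed; likewise for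
   comodule functors below. *)
Record opmonoidal (C D : monoidal) (F : functor C D) := Opmonoidal {
  op2 : forall x y : C, hom (F (x ⊗ y)) (F x ⊗ F y);
  op0 : hom (F tunit) tunit;
  op2_nat : forall (x x' y y' : C) (f : hom x x') (g : hom y y'),
    (fmap F f ⊠ fmap F g) ∘ op2 x y = op2 x' y' ∘ fmap F (f ⊠ g);
  op_coassoc : forall x y z : C,
    (idm (F x) ⊠ op2 y z) ∘ op2 x (y ⊗ z) ∘ fmap F (tassoc x y z)
      = tassoc (F x) (F y) (F z) ∘ (op2 x y ⊠ idm (F z)) ∘ op2 (x ⊗ y) z;
  op_counitl : forall x : C,
    tunitl (F x) ∘ (op0 ⊠ idm (F x)) ∘ op2 tunit x = fmap F (tunitl x);
  op_counitr : forall x : C,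
    tunitr (F x) ∘ (idm (F x) ⊠ op0) ∘ op2 x tunit = fmap F (tunitr x)
}.

Definition opmonoidal_nattrans (C D : monoidal) (F G : functor C D)
    (oF : opmonoidal F) (oG : opmonoidal G) (rho : nattrans F G) : Prop :=
  (forall x y : C, op2 oG x y ∘ rho (x ⊗ y) = (rho x ⊠ rho y) ∘ op2 oF x y)
  /\ op0 oG ∘ rho tunit = op0 oF.

Section OpmonoidalId.
Context (C : monoidal).

Lemma opmonoidal_id_coassoc (x y z : C) :
  (idm x ⊠ idm (y ⊗ z)) ∘ idm (x ⊗ (y ⊗ z)) ∘ tassoc x y z
    = tassoc x y z ∘ (idm (x ⊗ y) ⊠ idm z) ∘ idm (x ⊗ y ⊗ z).
Proof. by rewrite !bmap1 !cmp1m !cmpm1. Qed.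

Lemma opmonoidal_id_counitl (x : C) :
  tunitl x ∘ (idm tunit ⊠ idm x) ∘ idm (tunit ⊗ x) = tunitl x.
Proof. by rewrite bmap1 !cmpm1. Qed.

Lemma opmonoidal_id_counitr (x : C) :
  tunitr x ∘ (idm x ⊠ idm tunit) ∘ idm (x ⊗ tunit) = tunitr x.
Proof. by rewrite bmap1 !cmpm1. Qed.

Definition opmonoidal_id : opmonoidal (functor_id C) :=
  @Opmonoidal C C (functor_id C)
    (fun x y => idm (x ⊗ y)) (idm tunit)
    (fun x x' y y' f g => etrans (cmpm1 _) (esym (cmp1m _)))
    opmonoidal_id_coassoc opmonoidal_id_counitl opmonoidal_id_counitr.
End OpmonoidalId.

Section OpmonoidalComp.
Context (C D E : monoidal) (G : functor D E) (F : functor C D).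
Context (oG : opmonoidal G) (oF : opmonoidal F).
Let H := functor_comp G F.

Definition comp_op2 (x y : C) : hom (H (x ⊗ y)) (H x ⊗ H y) :=
  op2 oG (F x) (F y) ∘ fmap G (op2 oF x y).

Definition comp_op0 : hom (H tunit) tunit := op0 oG ∘ fmap G (op0 oF).

Lemma comp_op2_nat (x x' y y' : C) (f : hom x x') (g : hom y y') :
  (fmap H f ⊠ fmap H g) ∘ comp_op2 x y = comp_op2 x' y' ∘ fmap H (f ⊠ g).
Proof. by rewrite /comp_op2 /= cmpA op2_nat -!cmpA -!fmapM op2_nat. Qed.

Lemma comp_op_coassoc (x y z : C) :
  (idm (H x) ⊠ comp_op2 y z) ∘ comp_op2 x (y ⊗ z) ∘ fmap H (tassoc x y z)
    = tassoc (H x) (H y) (H z) ∘ (comp_op2 x y ⊠ idm (H z))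
        ∘ comp_op2 (x ⊗ y) z.
Proof.
rewrite /comp_op2 /=.
rewrite -{1}(cmp1m (idm (G (F x)))) -{1}(cmp1m (idm (G (F z)))) !bmapM.
have natl : (idm (G (F x)) ⊠ fmap G (op2 oF y z)) ∘ op2 oG (F x) (F (y ⊗ z))
    = op2 oG (F x) (F y ⊗ F z) ∘ fmap G (idm (F x) ⊠ op2 oF y z).
  by rewrite -op2_nat fmap1.
have natr : (fmap G (op2 oF x y) ⊠ idm (G (F z))) ∘ op2 oG (F (x ⊗ y)) (F z)
    = op2 oG (F x ⊗ F y) (F z) ∘ fmap G (op2 oF x y ⊠ idm (F z)).
  by rewrite -op2_nat fmap1.
rewrite !cmpA -[_ ∘ (idm _ ⊠ fmap G _) ∘ _]cmpA natl.
rewrite -[X in _ = X ∘ _]cmpA natr !cmpA -op_coassoc -!cmpA.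
by do 2![congr (_ ∘ _)]; rewrite -!fmapM !cmpA op_coassoc.
Qed.

Lemma comp_op_counitl (x : C) :
  tunitl (H x) ∘ (comp_op0 ⊠ idm (H x)) ∘ comp_op2 tunit x
    = fmap H (tunitl x).
Proof.
rewrite /comp_op2 /comp_op0 /= -{1}(cmp1m (idm (G (F x)))) bmapM.
have natl : (fmap G (op0 oF) ⊠ idm (G (F x))) ∘ op2 oG (F tunit) (F x)
    = op2 oG tunit (F x) ∘ fmap G (op0 oF ⊠ idm (F x)).
  by rewrite -op2_nat fmap1.
rewrite !cmpA -[X in X ∘ _]cmpA natl !cmpA op_counitl -!fmapM.
by rewrite op_counitl.
Qed.

Lemma comp_op_counitr (x : C) :
  tunitr (H x) ∘ (idm (H x) ⊠ comp_op0) ∘ comp_op2 x tunit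
    = fmap H (tunitr x).
Proof.
rewrite /comp_op2 /comp_op0 /= -{1}(cmp1m (idm (G (F x)))) bmapM.
have natr : (idm (G (F x)) ⊠ fmap G (op0 oF)) ∘ op2 oG (F x) (F tunit)
    = op2 oG (F x) tunit ∘ fmap G (idm (F x) ⊠ op0 oF).
  by rewrite -op2_nat fmap1.
rewrite !cmpA -[X in X ∘ _]cmpA natr !cmpA op_counitr -!fmapM.
by rewrite op_counitr.
Qed.

Definition opmonoidal_comp : opmonoidal H :=
  Opmonoidal comp_op2_nat comp_op_coassoc comp_op_counitl comp_op_counitr.
End OpmonoidalComp.

Record monad (C : category) := Monad {
  mfun :> functor C C;
  mmu : nattrans (functor_comp mfun mfun) mfun;
  meta : nattrans (functor_id C) mfun;
  mmuA : forall x : C, mmu x ∘ fmap mfun (mmu x) = mmu x ∘ mmu (mfun x);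
  mmu_eta : forall x : C, mmu x ∘ fmap mfun (meta x) = idm (mfun x);
  mmu_etaT : forall x : C, mmu x ∘ meta (mfun x) = idm (mfun x)
}.

Record bimonad (C : monoidal) := Bimonad {
  bmonad :> monad C;
  bop : opmonoidal bmonad;
  bmu_op : opmonoidal_nattrans (opmonoidal_comp bop bop) bop (mmu bmonad);
  beta_op : opmonoidal_nattrans (opmonoidal_id C) bop (meta bmonad)
}.

Section EilenbergMoore.
Context (C : category) (T : monad C).

Record algebra := Algebra {
  carrier :> C;
  alg : hom (T carrier) carrier;
  algM : alg ∘ fmap T alg = alg ∘ mmu T carrier;
  alg1 : alg ∘ meta T carrier = idm carrier
}.

Record alg_hom (a b : algebra) := AlgHom {
  ahom :> hom (carrier a) (carrier b);
  ahomP : ahom ∘ alg a = alg b ∘ fmap T ahom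
}.

Lemma alg_hom_eq (a b : algebra) (f g : alg_hom a b) :
  ahom f = ahom g -> f = g.
Proof.
case: f g => [f fP] [g gP] /= efg; subst g.
by rewrite (proof_irrelevance _ fP gP).
Qed.

Lemma alg_idP (a : algebra) : idm (carrier a) ∘ alg a = alg a ∘ fmap T (idm _).
Proof. by rewrite fmap1 cmp1m cmpm1. Qed.

Lemma alg_cmpP (a b c : algebra) (g : alg_hom b c) (f : alg_hom a b) :
  (g ∘ f) ∘ alg a = alg c ∘ fmap T (g ∘ f).
Proof. by rewrite fmapM -cmpA ahomP cmpA ahomP -cmpA. Qed.

Definition alg_id (a : algebra) : alg_hom a a := AlgHom (alg_idP a).

Definition alg_cmp (a b c : algebra) (g : alg_hom b c) (f : alg_hom a b) :
    alg_hom a c :=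
  AlgHom (alg_cmpP g f).

Lemma alg_cmpA (a b c d : algebra)
    (h : alg_hom c d) (g : alg_hom b c) (f : alg_hom a b) :
  alg_cmp h (alg_cmp g f) = alg_cmp (alg_cmp h g) f.
Proof. by apply: alg_hom_eq; apply: cmpA. Qed.

Lemma alg_cmp1m (a b : algebra) (f : alg_hom a b) : alg_cmp (alg_id b) f = f.
Proof. by apply: alg_hom_eq; apply: cmp1m. Qed.

Lemma alg_cmpm1 (a b : algebra) (f : alg_hom a b) : alg_cmp f (alg_id a) = f.
Proof. by apply: alg_hom_eq; apply: cmpm1. Qed.

Definition em : category :=
  @Category algebra alg_hom alg_id alg_cmp alg_cmpA alg_cmp1m alg_cmpm1.

Definition em_forget : functor em C :=
  @Functor em C carrier (fun a b f => ahom f)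
    (fun a => erefl) (fun a b c g f => erefl).

Lemma em_iso (a b : em) (f : hom a b) : is_iso (ahom f) -> is_iso f.
Proof.
case=> g [gf fg].
have gP : g ∘ alg b = alg a ∘ fmap T g.
  rewrite -[LHS]cmpm1 -(fmap1 T) -fg fmapM cmpA -[g ∘ _ ∘ _]cmpA -ahomP.
  by rewrite [g ∘ _]cmpA gf cmp1m.
by exists (AlgHom gP); split; apply: alg_hom_eq.
Qed.
End EilenbergMoore.

Section EMMonoidal.
Context (C : monoidal) (B : bimonad C).
Implicit Types a b c d : algebra B.

Definition em_tensor_alg a b : hom (B (carrier a ⊗ carrier b)) (carrier a ⊗ carrier b) :=
  (alg a ⊠ alg b) ∘ op2 (bop B) a b.

Lemma em_tensor_algM a b :
  em_tensor_alg a b ∘ fmap B (em_tensor_alg a b)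
    = em_tensor_alg a b ∘ mmu B (carrier a ⊗ carrier b).
Proof.
rewrite /em_tensor_alg fmapM !cmpA -[_ ∘ _ ∘ fmap B (_ ⊠ _)]cmpA -op2_nat.
rewrite !cmpA -bmapM !algM bmapM -!cmpA; congr (_ ∘ _).
by rewrite (proj1 (bmu_op B)).
Qed.

Lemma em_tensor_alg1 a b : em_tensor_alg a b ∘ meta B (carrier a ⊗ carrier b) = idm (carrier a ⊗ carrier b).
Proof.
by rewrite /em_tensor_alg -cmpA (proj1 (beta_op B)) /= cmpm1 -bmapM !alg1 bmap1.
Qed.

Definition em_tensor_ob a b : algebra B :=
  Algebra (em_tensor_algM a b) (em_tensor_alg1 a b).

Lemma em_tensor_homP a a' b b' (f : alg_hom a a') (g : alg_hom b b') :
  (ahom f ⊠ ahom g) ∘ em_tensor_alg a b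
    = em_tensor_alg a' b' ∘ fmap B (ahom f ⊠ ahom g).
Proof.
by rewrite /em_tensor_alg cmpA -bmapM !ahomP bmapM -cmpA op2_nat cmpA.
Qed.

Definition em_tensor_hom a a' b b' (f : alg_hom a a') (g : alg_hom b b') :
    alg_hom (em_tensor_ob a b) (em_tensor_ob a' b') :=
  @AlgHom _ B (em_tensor_ob a b) (em_tensor_ob a' b')
    (ahom f ⊠ ahom g) (em_tensor_homP f g).

Lemma em_tensor_hom1 a b :
  em_tensor_hom (alg_id a) (alg_id b) = alg_id (em_tensor_ob a b).
Proof. by apply: alg_hom_eq; apply: bmap1. Qed.

Lemma em_tensor_homM a a' a'' b b' b'' (f' : alg_hom a' a'')
    (f : alg_hom a a') (g' : alg_hom b' b'') (g : alg_hom b b') :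
  em_tensor_hom (alg_cmp f' f) (alg_cmp g' g)
    = alg_cmp (em_tensor_hom f' g') (em_tensor_hom f g).
Proof. by apply: alg_hom_eq; apply: bmapM. Qed.

Definition em_tensor : functor (prodcat (em B) (em B)) (em B) :=
  @Functor (prodcat (em B) (em B)) (em B)
    (fun p => em_tensor_ob p.1 p.2)
    (fun p q f => em_tensor_hom f.1 f.2)
    (fun p => em_tensor_hom1 p.1 p.2)
    (fun p q r g f => em_tensor_homM g.1 f.1 g.2 f.2).

Lemma em_unit_algM :
  op0 (bop B) ∘ fmap B (op0 (bop B)) = op0 (bop B) ∘ mmu B tunit.
Proof. by rewrite (proj2 (bmu_op B)). Qed.

Lemma em_unit_alg1 : op0 (bop B) ∘ meta B tunit = idm tunit.
Proof. by rewrite (proj2 (beta_op B)). Qed.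

Definition em_unit : algebra B := Algebra em_unit_algM em_unit_alg1.

Lemma em_tassocP a b c :
  tassoc (carrier a) b c ∘ alg (em_tensor_ob (em_tensor_ob a b) c)
    = alg (em_tensor_ob a (em_tensor_ob b c)) ∘ fmap B (tassoc (carrier a) b c).
Proof.
rewrite /= /em_tensor_alg /= /em_tensor_alg.
rewrite -[alg c in LHS]cmpm1 -[alg a in RHS]cmpm1 !bmapM.
rewrite !cmpA -tassoc_nat -!cmpA; congr (_ ∘ _).
by rewrite !cmpA op_coassoc.
Qed.

Lemma em_tunitlP a :
  tunitl (carrier a) ∘ alg (em_tensor_ob em_unit a)
    = alg a ∘ fmap B (tunitl (carrier a)).
Proof.
rewrite /= /em_tensor_alg /= -(cmp1m (op0 _)) -{1}[alg a]cmpm1 bmapM.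
by rewrite !cmpA -tunitl_nat -!cmpA; congr (_ ∘ _); rewrite !cmpA op_counitl.
Qed.

Lemma em_tunitrP a :
  tunitr (carrier a) ∘ alg (em_tensor_ob a em_unit)
    = alg a ∘ fmap B (tunitr (carrier a)).
Proof.
rewrite /= /em_tensor_alg /= -(cmp1m (op0 _)) -{1}[alg a]cmpm1 bmapM.
by rewrite !cmpA -tunitr_nat -!cmpA; congr (_ ∘ _); rewrite !cmpA op_counitr.
Qed.

Definition em_tassoc a b c :
    alg_hom (em_tensor_ob (em_tensor_ob a b) c)
            (em_tensor_ob a (em_tensor_ob b c)) :=
  @AlgHom _ B (em_tensor_ob (em_tensor_ob a b) c)
    (em_tensor_ob a (em_tensor_ob b c)) _ (em_tassocP a b c).

Definition em_tunitl a : alg_hom (em_tensor_ob em_unit a) a :=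
  @AlgHom _ B (em_tensor_ob em_unit a) a _ (em_tunitlP a).

Definition em_tunitr a : alg_hom (em_tensor_ob a em_unit) a :=
  @AlgHom _ B (em_tensor_ob a em_unit) a _ (em_tunitrP a).

Definition em_monoidal : monoidal.
Proof.
refine (@Monoidal (em B) em_tensor em_unit em_tassoc em_tunitl em_tunitr
          _ _ _ _ _ _ _ _).
- abstract (move=> a b c; apply: em_iso; apply: tassoc_iso).
- abstract (move=> a; apply: em_iso; apply: tunitl_iso).
- abstract (move=> a; apply: em_iso; apply: tunitr_iso).
- abstract (move=> a a' b b' c c' f g h; apply: alg_hom_eq; apply: tassoc_nat).
- abstract (move=> a a' f; apply: alg_hom_eq; apply: tunitl_nat).
- abstract (move=> a a' f; apply: alg_hom_eq; apply: tunitr_nat).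
- abstract (move=> a b c d; apply: alg_hom_eq; apply: tpentagon).
- abstract (move=> a b; apply: alg_hom_eq; apply: ttriangle).
Defined.

(* The carrier of a ⊗ b is definitionally carrier a ⊗ carrier b, and that of
   the unit is the unit, so the comultiplication and counit of the strict
   monoidal forgetful functor are literally identities. *)
Definition em_forget_op :
    @opmonoidal em_monoidal C (em_forget B : functor em_monoidal C) :=
  @Opmonoidal em_monoidal C (em_forget B)
    (fun a b => idm (carrier a ⊗ carrier b)) (idm tunit)
    (fun a a' b b' f g => etrans (cmpm1 _) (esym (cmp1m _)))
    (fun a b c => opmonoidal_id_coassoc (carrier a) (carrier b) (carrier c))
    (fun a => opmonoidal_id_counitl (carrier a))
    (fun a => opmonoidal_id_counitr (carrier a)).
End EMMonoidal.

Record comodule_functor (C D : monoidal) (M N : category)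
    (A : right_action C M) (A' : right_action D N)
    (F : functor C D) (oF : opmonoidal F) (G : functor M N) :=
  ComoduleFunctor {
  coact : forall (m : M) (x : C), hom (G (A (m, x))) (A' (G m, F x));
  coact_nat : forall (m m' : M) (x x' : C) (f : hom m m') (g : hom x x'),
    bmap A' (fmap G f) (fmap F g) ∘ coact m x
      = coact m' x' ∘ fmap G (bmap A f g);
  coact_coassoc : forall (m : M) (x y : C),
    aassoc A' (G m) (F x) (F y)
      ∘ bmap A' (idm (G m)) (op2 oF x y) ∘ coact m (x ⊗ y)
    = bmap A' (coact m x) (idm (F y)) ∘ coact (A (m, x)) y
      ∘ fmap G (aassoc A m x y);
  coact_counit : forall m : M,
    aunit A' (G m) ∘ bmap A' (idm (G m)) (op0 oF) ∘ coact m tunit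
      = fmap G (aunit A m)
}.

(* The coaction is the identity, which presupposes that its source and target
   are equal objects; they need not be convertible, hence eq_mor. *)
Definition strict_comodule_functor (C D : monoidal) (M N : category)
    (A : right_action C M) (A' : right_action D N)
    (F : functor C D) (oF : opmonoidal F) (G : functor M N)
    (delta : comodule_functor A A' oF G) : Prop :=
  exists e : forall (m : M) (x : C), G (A (m, x)) = A' (G m, F x),
    forall m x, coact delta m x = eq_mor (e m x).

Record coaction_on_monad (C : monoidal) (B : bimonad C) (M : category)
    (A : right_action C M) (K : monad M) := CoactionOnMonad {
  kcoact :> comodule_functor A A (bop B) K;
  kcoact_mu : forall (m : M) (x : C),
    coact kcoact m x ∘ mmu K (A (m, x))
      = bmap A (mmu K m) (mmu B x) ∘ coact kcoact (K m) (B x)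
          ∘ fmap K (coact kcoact m x);
  kcoact_eta : forall (m : M) (x : C),
    coact kcoact m x ∘ meta K (A (m, x)) = bmap A (meta K m) (meta B x)
}.

(* Right actions of the category of B-algebras on that of K-algebras for which
   the forgetful functor is strict. The coaction is an identity, so asking for
   its existence loses no data. *)
Definition forget_strict_action (C : monoidal) (B : bimonad C) (M : category)
    (A : right_action C M) (K : monad M) : Type :=
  {A' : right_action (em_monoidal B) (em K)
     | exists delta : comodule_functor A' A (em_forget_op B) (em_forget K),
         strict_comodule_functor delta}.

(* Main.v *)
Require Import Defs.
From mathcomp Require Import ssreflect ssrfun.
From Stdlib Require Import ProofIrrelevance FunctionalExtensionality.

(** Both sides are compared with liftings of the action to algebras: choices of
    a [K]-algebra structure on [a ◁ b] for each [K]-algebra [a] and [B]-algebra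
    [b], for which the maps [f ◁ g] and the constraints of [◁] are algebra
    morphisms.  A coaction [δ] gives the structure
    [(alg a ◁ alg b) ∘ δ]; conversely [δ m x] is recovered as the unique algebra
    morphism from the free algebra on [m ◁ x] to [free m ◁ free x] that extends
    [η m ◁ η x].  A strict action is a lifting because its morphism part
    and constraints are forced by faithfulness of the forgetful functor. *)

Set Implicit Arguments.
Unset Strict Implicit.
Unset Printing Implicit Defensive.

Local Open Scope cat_scope.

(** * Free algebras, and transport of algebra structures along equalities of carriers *)

Section FreeAlgebra.
Context (C : category) (T : monad C).

Definition free (x : C) : algebra T := Algebra (mmuA T x) (mmu_etaT T x).

Definition free_map (x y : C) (f : hom x y) : alg_hom (free x) (free y) :=
  @AlgHom _ _ (free x) (free y) (fmap T f) (nat_sq (mmu T) f).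

Definition free_counit (a : algebra T) : alg_hom (free (carrier a)) a :=
  @AlgHom _ _ (free (carrier a)) a (alg a) (esym (algM a)).

Lemma algebra_eq (x : C) (s t : hom (T x) x) sM s1 tM t1 :
  s = t -> @Algebra C T x s sM s1 = @Algebra C T x t tM t1.
Proof.
move=> st; subst t.
by rewrite (proof_irrelevance _ sM tM) (proof_irrelevance _ s1 t1).
Qed.

(** Strictness only gives a propositional equality of carriers, so structure maps have to be
    transported along it. Leaving the target [x] a variable allows elimination of [e] in the lemmas
    below. *)
Definition alg_cast (a : algebra T) (x : C) (e : carrier a = x) : hom (T x) x :=
  match e in _ = z return hom (T z) z with erefl => alg a end.

Lemma alg_castM (a : algebra T) (x : C) (e : carrier a = x) :
  alg_cast e ∘ fmap T (alg_cast e) = alg_cast e ∘ mmu T x.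
Proof. case: x / e; exact: algM. Qed.

Lemma alg_cast1 (a : algebra T) (x : C) (e : carrier a = x) :
  alg_cast e ∘ meta T x = idm x.
Proof. case: x / e; exact: alg1. Qed.

Lemma alg_cast_eq (a : algebra T) (x : C) (e : carrier a = x) sM s1 :
  a = @Algebra C T x (alg_cast e) sM s1.
Proof.
case: x / e sM s1 => sM s1; case: a sM s1 => x s sM s1 /= sM' s1'.
exact: algebra_eq.
Qed.

Lemma alg_cast_id (a : algebra T) (e : carrier a = carrier a) :
  alg_cast e = alg a.
Proof. by rewrite (proof_irrelevance _ e erefl). Qed.

Lemma eq_mor_algP (a : algebra T) (x : C) (e : carrier a = x) :
  eq_mor e ∘ alg a = alg_cast e ∘ fmap T (eq_mor e).
Proof. by case: x / e; rewrite /= fmap1 cmp1m cmpm1. Qed.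
End FreeAlgebra.

(** * Cancellation of identity morphisms along equalities of objects *)

Lemma eq_mor_inj (C : category) (x y z : C) (e : x = y) (f g : hom z x) :
  eq_mor e ∘ f = eq_mor e ∘ g -> f = g.
Proof. by case: y / e; rewrite /= !cmp1m. Qed.

Lemma fmap_eq_mor_surj (C D : category) (F : functor C D) (x y : C) (z : D)
    (e : x = y) (f g : hom (F y) z) :
  f ∘ fmap F (eq_mor e) = g ∘ fmap F (eq_mor e) -> f = g.
Proof. by case: y / e f g => f g /=; rewrite fmap1 !cmpm1. Qed.

Lemma bmap_eq_mor_inj (C D E : category) (F : functor (prodcat C D) E)
    (x x' : C) (y : D) (z : E) (e : x = x') (f g : hom z (F (x, y))) :
  bmap F (eq_mor e) (idm y) ∘ f = bmap F (eq_mor e) (idm y) ∘ g -> f = g.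
Proof. by case: x' / e => /=; rewrite bmap1 !cmp1m. Qed.

(** * Comultiplication and counit of the bimonad as morphisms of algebras *)

Section FreeMonoidal.
Context (C : monoidal) (B : bimonad C).

(** This is the opmonoidality of [mmu B] read as a statement about free algebras; it allows
    naturality of a lifting to be applied to [op2]. *)
Lemma free_op2P (x y : C) :
  op2 (bop B) x y ∘ alg (free B (x ⊗ y))
    = alg (em_tensor_ob (free B x) (free B y)) ∘ fmap B (op2 (bop B) x y).
Proof. by rewrite /= /em_tensor_alg -cmpA (proj1 (bmu_op B)). Qed.

Definition free_op2 (x y : C) :
    alg_hom (free B (x ⊗ y)) (em_tensor_ob (free B x) (free B y)) :=
  @AlgHom _ _ _ (em_tensor_ob (free B x) (free B y)) _ (free_op2P x y).

Lemma free_op0P :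
  op0 (bop B) ∘ alg (free B tunit) = alg (em_unit B) ∘ fmap B (op0 (bop B)).
Proof. by rewrite /= (proj2 (bmu_op B)). Qed.

Definition free_op0 : alg_hom (free B tunit) (em_unit B) :=
  @AlgHom _ _ (free B tunit) (em_unit B) _ free_op0P.
End FreeMonoidal.

(** * Liftings of the action to algebras *)

Section ActionLift.
Context (C : monoidal) (B : bimonad C) (M : category).
Context (A : right_action C M) (K : monad M).

(** Only [lalg] is data: morphism part and constraints are those of [A], and being algebra morphisms
    is a property of them. *)
Record action_lift := ActionLift {
  lalg : forall (a : algebra K) (b : algebra B),
    hom (K (A (carrier a, carrier b))) (A (carrier a, carrier b));
  lalgM : forall a b,
    lalg a b ∘ fmap K (lalg a b) = lalg a b ∘ mmu K (A (carrier a, carrier b));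
  lalg1 : forall a b,
    lalg a b ∘ meta K (A (carrier a, carrier b)) = idm (A (carrier a, carrier b));
  lalg_nat : forall a a' b b' (f : alg_hom a a') (g : alg_hom b b'),
    bmap A (ahom f) (ahom g) ∘ lalg a b
      = lalg a' b' ∘ fmap K (bmap A (ahom f) (ahom g));
  lalg_assoc : forall a b c,
    aassoc A (carrier a) (carrier b) (carrier c) ∘ lalg a (em_tensor_ob b c)
      = lalg (Algebra (lalgM a b) (lalg1 a b)) c
          ∘ fmap K (aassoc A (carrier a) (carrier b) (carrier c));
  lalg_unit : forall a,
    aunit A (carrier a) ∘ lalg a (em_unit B)
      = alg a ∘ fmap K (aunit A (carrier a))
}.

Definition lift_ob (L : action_lift) a b : algebra K :=
  Algebra (lalgM L a b) (lalg1 L a b).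

Lemma action_lift_eq (L L' : action_lift) :
  (forall a b, lalg L a b = lalg L' a b) -> L = L'.
Proof.
case: L L' => [l lM l1 ln la lu] [l' lM' l1' ln' la' lu'] /= ll.
have {}ll : l = l'.
  by apply: functional_extensionality_dep => a;
     apply: functional_extensionality_dep => b.
subst l'.
have ? := proof_irrelevance _ lM lM'; subst lM'.
have ? := proof_irrelevance _ l1 l1'; subst l1'.
by rewrite (proof_irrelevance _ ln ln') (proof_irrelevance _ la la')
  (proof_irrelevance _ lu lu').
Qed.

Lemma coaction_eq (d d' : coaction_on_monad B A K) :
  (forall m x, coact d m x = coact d' m x) -> d = d'.
Proof.
case: d d' => [[d dn da du] dm de] [[d' dn' da' du'] dm' de'] /= dd.
have {}dd : d = d'.
  by apply: functional_extensionality_dep => m;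
     apply: functional_extensionality_dep => x.
subst d'.
have ? := proof_irrelevance _ dn dn'; subst dn'.
have ? := proof_irrelevance _ da da'; subst da'.
have ? := proof_irrelevance _ du du'; subst du'.
by rewrite (proof_irrelevance _ dm dm') (proof_irrelevance _ de de').
Qed.

(** * From coactions to liftings *)

Section LiftOfCoaction.
Variable d : coaction_on_monad B A K.

Definition coaction_alg (a : algebra K) (b : algebra B) :
    hom (K (A (carrier a, carrier b))) (A (carrier a, carrier b)) :=
  bmap A (alg a) (alg b) ∘ coact d (carrier a) (carrier b).

Lemma coaction_algM a b :
  coaction_alg a b ∘ fmap K (coaction_alg a b)
    = coaction_alg a b ∘ mmu K (A (carrier a, carrier b)).
Proof.
rewrite /coaction_alg -[RHS]cmpA kcoact_mu !cmpA -bmapM -!algM bmapM fmapM.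
by rewrite !cmpA; congr (_ ∘ _); rewrite -!cmpA coact_nat.
Qed.

Lemma coaction_alg1 a b :
  coaction_alg a b ∘ meta K (A (carrier a, carrier b))
    = idm (A (carrier a, carrier b)).
Proof. by rewrite /coaction_alg -cmpA kcoact_eta -bmapM !alg1 bmap1. Qed.

Lemma coaction_alg_nat a a' b b' (f : alg_hom a a') (g : alg_hom b b') :
  bmap A (ahom f) (ahom g) ∘ coaction_alg a b
    = coaction_alg a' b' ∘ fmap K (bmap A (ahom f) (ahom g)).
Proof. by rewrite /coaction_alg cmpA -bmapM !ahomP bmapM -!cmpA coact_nat. Qed.

Lemma coaction_alg_assoc a b c :
  aassoc A (carrier a) (carrier b) (carrier c)
      ∘ coaction_alg a (em_tensor_ob b c)
    = coaction_alg (Algebra (coaction_algM a b) (coaction_alg1 a b)) c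
        ∘ fmap K (aassoc A (carrier a) (carrier b) (carrier c)).
Proof.
rewrite /coaction_alg /= /em_tensor_alg /coaction_alg.
(* Padding with identities lets [bmapM] split the structure maps off; they pass through [aassoc] by
   naturality, and coassociativity handles the rest. *)
rewrite -[alg c in RHS]cmpm1 -[alg a in LHS]cmpm1 !bmapM.
rewrite !cmpA -aassoc_nat -!cmpA; congr (_ ∘ _).
by rewrite !cmpA coact_coassoc.
Qed.

Lemma coaction_alg_unit a :
  aunit A (carrier a) ∘ coaction_alg a (em_unit B)
    = alg a ∘ fmap K (aunit A (carrier a)).
Proof.
rewrite /coaction_alg /= -{1}[alg a]cmpm1 -[op0 _]cmp1m bmapM.
by rewrite !cmpA -aunit_nat -!cmpA; congr (_ ∘ _); rewrite !cmpA coact_counit.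
Qed.

Definition lift_of_coaction : action_lift :=
  ActionLift coaction_alg_nat coaction_alg_assoc coaction_alg_unit.
End LiftOfCoaction.

(** * From liftings to coactions *)

Section CoactionOfLift.
Variable L : action_lift.

Definition lift_coact (m : M) (x : C) : hom (K (A (m, x))) (A (K m, B x)) :=
  lalg L (free K m) (free B x) ∘ fmap K (bmap A (meta K m) (meta B x)).

Lemma lift_coact_eta (m : M) (x : C) :
  lift_coact m x ∘ meta K (A (m, x)) = bmap A (meta K m) (meta B x).
Proof. by rewrite /lift_coact -cmpA (nat_sq (meta K)) cmpA lalg1 cmp1m. Qed.

Lemma lift_coactP (m : M) (x : C) :
  lift_coact m x ∘ alg (free K (A (m, x)))
    = alg (lift_ob L (free K m) (free B x)) ∘ fmap K (lift_coact m x).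
Proof.
have lM := lalgM L (free K m) (free B x).
by rewrite /lift_coact /= -cmpA (nat_sq (mmu K)) cmpA -lM -cmpA -(fmapM K).
Qed.

Definition lift_coact_hom (m : M) (x : C) :
    alg_hom (free K (A (m, x))) (lift_ob L (free K m) (free B x)) :=
  @AlgHom _ _ _ (lift_ob L (free K m) (free B x)) _ (lift_coactP m x).

(** A lifting is determined by its values on free algebras: naturality at the counits [alg a] and
    [alg b] of the free-forgetful adjunction, followed by the unit laws of both algebras. *)
Lemma lalg_coact a b :
  lalg L a b
    = bmap A (alg a) (alg b) ∘ lift_coact (carrier a) (carrier b).
Proof.
rewrite /lift_coact cmpA.
rewrite (lalg_nat L (free_counit a) (free_counit b)) -cmpA -(fmapM K) /=.
by rewrite -bmapM !alg1 bmap1 fmap1 cmpm1.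
Qed.

Lemma lift_coact_nat (m m' : M) (x x' : C) (f : hom m m') (g : hom x x') :
  bmap A (fmap K f) (fmap B g) ∘ lift_coact m x
    = lift_coact m' x' ∘ fmap K (bmap A f g).
Proof.
rewrite /lift_coact cmpA (lalg_nat L (free_map K f) (free_map B g)).
by rewrite -!cmpA -!(fmapM K) -!bmapM (nat_sq (meta K)) (nat_sq (meta B)).
Qed.

(** Naturality of [lalg] at the algebra morphisms [free_op2] and [lift_coact_hom] brings both sides
    to the structure on [(free m ◁ free x) ◁ free y] after a map under [K]. The maps under [K] agree
    because [meta B] is opmonoidal. *)
Lemma lift_coact_coassoc (m : M) (x y : C) :
  aassoc A (K m) (B x) (B y)
      ∘ bmap A (idm (K m)) (op2 (bop B) x y) ∘ lift_coact m (x ⊗ y)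
    = bmap A (lift_coact m x) (idm (B y)) ∘ lift_coact (A (m, x)) y
      ∘ fmap K (aassoc A m x y).
Proof.
have nl := lalg_nat L (alg_id (free K m)) (free_op2 B x y).
have nr := lalg_nat L (lift_coact_hom m x) (alg_id (free B y)).
rewrite /= in nl nr.
(* The occurrence inside [bmap] stays folded, to match [nr]. *)
rewrite {1 3}/lift_coact.
rewrite -[LHS]cmpA [bmap A (idm (K m)) _ ∘ _]cmpA nl [bmap A _ _ ∘ (_ ∘ _)]cmpA nr.
rewrite !cmpA (lalg_assoc L (free K m) (free B x) (free B y)) -!cmpA.
congr (_ ∘ _); rewrite -!(fmapM K); congr (fmap K _).
rewrite -bmapM cmp1m (proj1 (beta_op B)) /= cmpm1 -aassoc_nat.
by rewrite [RHS]cmpA -bmapM cmp1m lift_coact_eta.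
Qed.

Lemma lift_coact_counit (m : M) :
  aunit A (K m) ∘ bmap A (idm (K m)) (op0 (bop B)) ∘ lift_coact m tunit
    = fmap K (aunit A m).
Proof.
have n0 := lalg_nat L (alg_id (free K m)) (free_op0 B).
rewrite /= in n0.
rewrite /lift_coact -cmpA [bmap A (idm (K m)) _ ∘ _]cmpA n0.
rewrite !cmpA (lalg_unit L (free K m)) -!cmpA -!(fmapM K) -bmapM cmp1m.
rewrite (proj2 (beta_op B)) /= -aunit_nat fmapM.
by rewrite cmpA mmu_eta cmp1m.
Qed.

(** This is [lift_coactP] with the structure map on [free (K := K) m ◁ free x] rewritten by
    [lalg_coact]. *)
Lemma lift_coact_mu (m : M) (x : C) :
  lift_coact m x ∘ mmu K (A (m, x))
    = bmap A (mmu K m) (mmu B x) ∘ lift_coact (K m) (B x)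
        ∘ fmap K (lift_coact m x).
Proof.
have := lift_coactP m x; rewrite /= => ->.
by rewrite (lalg_coact (free K m) (free B x)).
Qed.

Definition coaction_of_lift : coaction_on_monad B A K :=
  @CoactionOnMonad _ _ _ _ _
    (@ComoduleFunctor C C M M A A B (bop B) K lift_coact
      lift_coact_nat lift_coact_coassoc lift_coact_counit)
    lift_coact_mu lift_coact_eta.
End CoactionOfLift.

(** * The bijection between coactions and liftings *)

Lemma lift_of_coactionK : cancel lift_of_coaction coaction_of_lift.
Proof.
move=> d; apply: coaction_eq => m x /=; rewrite /lift_coact /= /coaction_alg /=.
by rewrite -cmpA -coact_nat cmpA -bmapM !mmu_eta bmap1 cmp1m.
Qed.

Lemma coaction_of_liftK : cancel coaction_of_lift lift_of_coaction.
Proof. by move=> L; apply: action_lift_eq => a b; rewrite [RHS]lalg_coact. Qed.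

(** * From liftings to strict actions *)

Section ActionOfLift.
Variable L : action_lift.

Definition lift_hom a a' b b' (f : alg_hom a a') (g : alg_hom b b') :
    alg_hom (lift_ob L a b) (lift_ob L a' b') :=
  @AlgHom _ K (lift_ob L a b) (lift_ob L a' b') _ (lalg_nat L f g).

Lemma lift_hom1 a b : lift_hom (alg_id a) (alg_id b) = alg_id (lift_ob L a b).
Proof. apply: alg_hom_eq; exact: bmap1. Qed.

Lemma lift_homM a a' a'' b b' b'' (f' : alg_hom a' a'')
    (f : alg_hom a a') (g' : alg_hom b' b'') (g : alg_hom b b') :
  lift_hom (alg_cmp f' f) (alg_cmp g' g)
    = alg_cmp (lift_hom f' g') (lift_hom f g).
Proof. apply: alg_hom_eq; exact: bmapM. Qed.

Definition lift_act : functor (prodcat (em K) (em_monoidal B)) (em K) :=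
  @Functor (prodcat (em K) (em_monoidal B)) (em K)
    (fun p => lift_ob L p.1 p.2) (fun p q f => lift_hom f.1 f.2)
    (fun p => lift_hom1 p.1 p.2)
    (fun p q r g f => lift_homM g.1 f.1 g.2 f.2).

Definition lift_assoc a b c :
    alg_hom (lift_ob L a (em_tensor_ob b c)) (lift_ob L (lift_ob L a b) c) :=
  @AlgHom _ K (lift_ob L a (em_tensor_ob b c)) (lift_ob L (lift_ob L a b) c)
    _ (lalg_assoc L a b c).

Definition lift_unit a : alg_hom (lift_ob L a (em_unit B)) a :=
  @AlgHom _ K (lift_ob L a (em_unit B)) a _ (lalg_unit L a).

(** The forgetful functor is faithful and reflects isomorphisms, so every axiom is inherited from
    [A]. *)
Definition lift_action : right_action (em_monoidal B) (em K).
Proof.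
refine (@RightAction (em_monoidal B) (em K) lift_act lift_assoc lift_unit
          _ _ _ _ _ _).
- abstract (move=> a b c; apply: em_iso; apply: aassoc_iso).
- abstract (move=> a; apply: em_iso; apply: aunit_iso).
- abstract (move=> a a' b b' c c' f g h; apply: alg_hom_eq; apply: aassoc_nat).
- abstract (move=> a a' f; apply: alg_hom_eq; apply: aunit_nat).
- abstract (move=> a b c d; apply: alg_hom_eq; apply: apentagon).
- abstract (move=> a b; apply: alg_hom_eq; apply: atriangle).
Defined.

Definition lift_forget :
    comodule_functor lift_action A (em_forget_op B) (em_forget K).
Proof.
refine (@ComoduleFunctor (em_monoidal B) C (em K) M lift_action A (em_forget B)
          (em_forget_op B) (em_forget K)
          (fun a b => idm (A (carrier a, carrier b))) _ _ _).
- abstract (by move=> a a' b b' f g; rewrite cmpm1 cmp1m).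
- abstract (by move=> a b c /=; rewrite !bmap1 !cmpm1 !cmp1m).
- abstract (by move=> a /=; rewrite bmap1 !cmpm1).
Defined.

Lemma lift_forget_strict : strict_comodule_functor lift_forget.
Proof. by exists (fun a b => erefl). Qed.

Definition action_of_lift : forget_strict_action B A K :=
  exist _ lift_action (ex_intro _ lift_forget lift_forget_strict).
End ActionOfLift.

(** * Strict actions described over the underlying category *)

Definition action_carrier (A' : right_action (em_monoidal B) (em K)) : Prop :=
  forall (a : algebra K) (b : algebra B),
    carrier (A' (a, b)) = A (carrier a, carrier b).

Record lifts_along (A' : right_action (em_monoidal B) (em K))
    (e : action_carrier A') : Prop := LiftsAlong {
  lifts_nat : forall a a' b b' (f : alg_hom a a') (g : alg_hom b b'),
    bmap A (ahom f) (ahom g) ∘ eq_mor (e a b)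
      = eq_mor (e a' b') ∘ ahom (@bmap (em K) (em B) _ A' a a' b b' f g);
  lifts_assoc : forall a b c,
    aassoc A (carrier a) (carrier b) (carrier c)
        ∘ eq_mor (e a (em_tensor_ob b c))
      = bmap A (eq_mor (e a b)) (idm (carrier c)) ∘ eq_mor (e (A' (a, b)) c)
          ∘ ahom (aassoc A' a b c);
  lifts_unit : forall a,
    aunit A (carrier a) ∘ eq_mor (e a (em_unit B)) = ahom (aunit A' a)
}.

Lemma strict_lifts (S : forget_strict_action B A K) :
  exists e, @lifts_along (sval S) e.
Proof.
case: S => A' [d [e de]] /=; exists e; split.
- by move=> a a' b b' f g; rewrite -!de; exact: (coact_nat d f g).
- move=> a b c; have := coact_coassoc d a b c.
  by rewrite !de /= bmap1 cmpm1.
- by move=> a; have := coact_counit d a; rewrite !de /= bmap1 cmpm1.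
Qed.

(** Once the objects agree, [lifts_along] expresses morphism part and constraints through those of
    [A] up to the monomorphisms [eq_mor]. The fields are identified one by one, as the types of
    later ones depend on earlier ones. *)
Lemma action_lift_inj A1 A2 e1 e2 : @lifts_along A1 e1 -> @lifts_along A2 e2 ->
  (forall a b, A1 (a, b) = A2 (a, b)) -> A1 = A2.
Proof.
case: A1 e1 => [[o1 m1 u1 c1] as1 un1 i1 j1 an1 unn1 p1 t1] e1.
case: A2 e2 => [[o2 m2 u2 c2] as2 un2 i2 j2 an2 unn2 p2 t2] e2.
move=> [/= n1 la1 lu1] [/= n2 la2 lu2] /= oo.
have ? : o1 = o2 by apply: functional_extensionality_dep => -[a b].
subst o2; have ? := proof_irrelevance _ e1 e2; subst e2.
have ? : m1 = m2.
  apply: functional_extensionality_dep => -[a b].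
  apply: functional_extensionality_dep => -[a' b'].
  apply: functional_extensionality_dep => -[f g].
  apply: alg_hom_eq; apply: (eq_mor_inj (e := e1 a' b')).
  by rewrite -[LHS]n1 -[RHS]n2.
subst m2.
have ? := proof_irrelevance _ u1 u2; subst u2.
have ? := proof_irrelevance _ c1 c2; subst c2.
have ? : as1 = as2.
  apply: functional_extensionality_dep => a.
  apply: functional_extensionality_dep => b.
  apply: functional_extensionality_dep => c.
  apply: alg_hom_eq; apply: (eq_mor_inj (e := e1 (o1 (a, b)) c)).
  apply: (bmap_eq_mor_inj (e := e1 a b)).
  by rewrite !cmpA -[LHS]la1 -[RHS]la2.
subst as2.
have ? : un1 = un2.
  apply: functional_extensionality_dep => a.
  by apply: alg_hom_eq; rewrite -lu1 -lu2.
subst un2.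
have ? := proof_irrelevance _ i1 i2; subst i2.
have ? := proof_irrelevance _ j1 j2; subst j2.
have ? := proof_irrelevance _ an1 an2; subst an2.
have ? := proof_irrelevance _ unn1 unn2; subst unn2.
have ? := proof_irrelevance _ p1 p2; subst p2.
by have ? := proof_irrelevance _ t1 t2; subst t2.
Qed.

(** * From strict actions to liftings *)

Section LiftOfAction.
Variable S : forget_strict_action B A K.
Notation A' := (sval S).

Lemma action_carrierP : action_carrier A'.
Proof. by case: (strict_lifts S). Qed.

Lemma action_lifts : lifts_along action_carrierP.
Proof.
by case: (strict_lifts S) => e; rewrite (proof_irrelevance _ e action_carrierP).
Qed.

Notation e := action_carrierP.

Definition action_alg a b :
    hom (K (A (carrier a, carrier b))) (A (carrier a, carrier b)) :=
  alg_cast (e a b).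

Lemma action_alg_nat a a' b b' (f : alg_hom a a') (g : alg_hom b b') :
  bmap A (ahom f) (ahom g) ∘ action_alg a b
    = action_alg a' b' ∘ fmap K (bmap A (ahom f) (ahom g)).
Proof.
(* Precomposing with [eq_mor] under [K] moves the equation to [A' (a, b)], where the maps are
   algebra morphisms by construction. *)
apply: (fmap_eq_mor_surj (e := e a b)).
rewrite -cmpA -eq_mor_algP cmpA (lifts_nat action_lifts f g).
rewrite -[LHS]cmpA ahomP cmpA eq_mor_algP -!cmpA -!(fmapM K).
by rewrite -(lifts_nat action_lifts f g).
Qed.

Definition action_ob a b : algebra K :=
  Algebra (alg_castM (e a b)) (alg_cast1 (e a b)).

Definition action_eq_hom a b : alg_hom (A' (a, b)) (action_ob a b) :=
  @AlgHom _ K (A' (a, b)) (action_ob a b) _ (eq_mor_algP (e a b)).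

Lemma action_alg_assoc a b c :
  aassoc A (carrier a) (carrier b) (carrier c)
      ∘ action_alg a (em_tensor_ob b c)
    = action_alg (action_ob a b) c
        ∘ fmap K (aassoc A (carrier a) (carrier b) (carrier c)).
Proof.
apply: (fmap_eq_mor_surj (e := e a (em_tensor_ob b c))).
rewrite -cmpA -eq_mor_algP cmpA (lifts_assoc action_lifts).
rewrite -[LHS]cmpA ahomP cmpA -[_ ∘ eq_mor _ ∘ _]cmpA eq_mor_algP.
(* The identity [eq_mor (e a b)] is itself an algebra morphism onto the transported algebra, so
   naturality applies to it. *)
rewrite cmpA (action_alg_nat (action_eq_hom a b) (alg_id c)) -!cmpA.
by rewrite -!(fmapM K) cmpA -(lifts_assoc action_lifts).
Qed.

Lemma action_alg_unit a :
  aunit A (carrier a) ∘ action_alg a (em_unit B)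
    = alg a ∘ fmap K (aunit A (carrier a)).
Proof.
apply: (fmap_eq_mor_surj (e := e a (em_unit B))).
rewrite -cmpA -eq_mor_algP cmpA (lifts_unit action_lifts) ahomP.
by rewrite -cmpA -(fmapM K) (lifts_unit action_lifts).
Qed.

Definition lift_of_action : action_lift :=
  ActionLift action_alg_nat action_alg_assoc action_alg_unit.
End LiftOfAction.

(** * The bijection between liftings and strict actions *)

Lemma action_of_liftK : cancel action_of_lift lift_of_action.
Proof. move=> L; apply: action_lift_eq => a b; exact: (@alg_cast_id _ _ (lift_ob L a b)). Qed.

Lemma lift_of_actionK : cancel lift_of_action action_of_lift.
Proof.
move=> S; have l1 := action_lifts (action_of_lift (lift_of_action S)).
have l2 := action_lifts S.
have: sval (action_of_lift (lift_of_action S)) = sval S.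
  apply: (action_lift_inj l1 l2) => a b.
  (* An algebra equals its transport along the equality of carriers, so the two actions agree on
     objects. *)
  by rewrite [RHS](alg_cast_eq (alg_castM (action_carrierP S a b)) (alg_cast1 _)).
move: (action_of_lift _) {l1 l2} => S'; case: S' S => A1 d1 [A2 d2] /= E.
exact: subset_eq_compat.
Qed.
End ActionLift.

Theorem theorem2 (C : monoidal) (B : bimonad C) (M : category)
    (A : right_action C M) (K : monad M) :
  exists f : coaction_on_monad B A K -> forget_strict_action B A K,
    bijective f.
Proof.
exists (fun d => action_of_lift (lift_of_coaction d)).
apply: bij_comp.
- exact: Bijective (@action_of_liftK _ _ _ _ _) (@lift_of_actionK _ _ _ _ _).
- exact: Bijective (@lift_of_coactionK _ _ _ _ _) (@coaction_of_liftK _ _ _ _ _).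
Qed.
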